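(* The Bruhat decomposition gives an asymptotically tight parametrization of all $2^{2n^2+O(n)}$ stabilizer circuits: for every $n\ge1$ the map $$\mathcal{B}_n\times W_n\times\mathcal{B}_n\to\mathrm{Sp}(2n,\mathbb{F}_2),\qquad (b_1,w,b_2)\mapsto b_1wb_2,$$ is surjective, and the number of Boolean degrees of freedom $\log_2|\mathcal{B}_n\times W_n\times\mathcal{B}_n|$ of this parametrization is $2n^2+o(n^2)$ as $n\to\infty$, which agrees to leading order with $\log_2|\mathrm{Sp}(2n,\mathbb{F}_2)|=2n^2+O(n)$.
   Context: $\mathrm{Sp}(2n,\mathbb{F}_2)=\{S\in\mathrm{GL}(2n,\mathbb{F}_2): S^tJS=J\}$ with $J=\begin{pmatrix}\mathbf 0_n&\mathbf 1_n\\ \mathbf 1_n&\mathbf 0_n\end{pmatrix}$; it is isomorphic to the group of $n$-qubit stabilizer circuits (circuits over Hadamard, Phase and CNOT gates) modulo global phases and Pauli operators. The group $\mathcal{B}_n$ is $$\mathcal{B}_n=\left\{\begin{pmatrix}A&\mathbf 0\\ \mathbf 0&(A^t)^{-1}\end{pmatrix}\begin{pmatrix}\mathbf 1&C\\ \mathbf 0&\mathbf 1\end{pmatrix}: A\in\mathrm{GL}(n,\mathbb{F}_2)\text{ upper triangular},\ C\in\mathbb{F}_2^{n\times n},\ C=C^t\right\}.$$ $W_n\subseteq\mathrm{Sp}(2n,\mathbb{F}_2)$ is the group generated by the symplectic matrices of all Hadamard gates (the permutation matrices exchanging coordinates $k$ and $n+k$, $k=1,\dots,n$) and of all qubit permutations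 (the matrices $\mathrm{diag}(\tau,\tau)$ with $\tau$ an $n\times n$ permutation matrix). The number of Boolean degrees of freedom of a finite set is the base-2 logarithm of its cardinality. *)

(* Defs.v *)
From HB Require Import structures.
From mathcomp Require Import all_boot all_order all_algebra all_fingroup.
From mathcomp Require Import all_classical all_reals all_analysis.

Set Implicit Arguments.
Unset Strict Implicit.
Unset Printing Implicit Defensive.

Import GRing.Theory.
Local Open Scope ring_scope.

Definition sympl_form (n : nat) : 'M['F_2]_(n + n) :=
  block_mx 0 1%:M 1%:M 0.

(* The library's upper/lower convention: [is_trig_mx] means lower triangular,
   hence the transpose. *)
Definition borel_mx (n : nat) (M : 'M['F_2]_(n + n)) : bool :=
  [exists A : 'M['F_2]_n, exists C : 'M['F_2]_n,
    [&& A \in unitmx, is_trig_mx A^T, C == C^T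
      & M == block_mx A 0 0 (invmx A^T) *m block_mx 1%:M C 0 1%:M]].

Definition hadamard_mx (n : nat) (k : 'I_n) : 'M['F_2]_(n + n) :=
  tperm_mx (lshift n k) (rshift n k).

Definition qubit_perm_mx (n : nat) (s : 'S_n) : 'M['F_2]_(n + n) :=
  block_mx (perm_mx s) 0 0 (perm_mx s).

(* The library's general linear groups [{'GL_n[F]}] consist of matrices of
   size n.-1.+1, so as to be nontrivial rings. In the same way [Sp n], [Borel n]
   and [Weyl n] below have their intended meaning for 0 < n only (their value
   at 0 is the one at 1). *)
Notation qGL n := {'GL_(n.-1.+1 + n.-1.+1)['F_2]}.

Definition GLmx (n : nat) (g : qGL n) : 'M['F_2]_(n.-1.+1 + n.-1.+1) :=
  GLval g.

Definition Sp (n : nat) : {set qGL n} :=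
  [set S | (GLmx S)^T *m sympl_form _ *m GLmx S == sympl_form _].

Definition Borel (n : nat) : {set qGL n} := [set b | borel_mx (GLmx b)].

Definition Weyl (n : nat) : {set qGL n} :=
  <<[set h | [exists k, GLmx h == hadamard_mx k]]
    :|: [set p | [exists s, GLmx p == qubit_perm_mx s]]>>%g.

Definition bruhat_dom (n : nat) : {set qGL n * qGL n * qGL n} :=
  finset.setX (finset.setX (Borel n) (Weyl n)) (Borel n).

Definition bruhat_map (n : nat) (p : qGL n * qGL n * qGL n) : qGL n :=
  (p.1.1 * p.1.2 * p.2)%g.

Definition boolean_dof (R : realType) (T : finType) (A : {set T}) : R :=
  ln #|A|%:R / ln 2.

(* Main.v *)
(* Order the symplectic basis as e_1 < ... < e_n < f_n < ... < f_1. The Borel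
   group is then the group of upper triangular symplectic matrices, and W_n
   that of the permutation matrices commuting with the exchange of e_k and f_k.
   For surjectivity, the column e_k of a symplectic matrix is cleared from the
   left by an upper triangular Eichler transformation pivoting on its last
   nonzero entry, the row of that pivot is cleared from the right, and the
   symplectic relation makes the column f_k a unit vector as well.
   For the cardinalities, |B_n| = 2^(n^2), |W_n| <= (2n)!, the map
   (b_1, b_2) |-> b_1^T b_2 is injective on B_n x B_n, whence
   |Sp| >= 2^(2n^2), and following the stabilizers of the successive basis
   vectors gives |Sp| <= 2^(2n) 2^(2n-1) ... 2^1 = 2^(2n^2+n). *)
Require Import Defs.
From mathcomp Require Import all_boot all_order all_algebra all_fingroup.
From mathcomp Require Import all_classical all_reals all_analysis.
From mathcomp Require Import zify ring lra.

Set Implicit Arguments.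
Unset Strict Implicit.
Unset Printing Implicit Defensive.

Import Order.TTheory GRing.Theory Num.Theory.
Import numFieldNormedType.Exports.
Local Open Scope classical_set_scope.
Local Open Scope ring_scope.

(** * Arithmetic in the field with two elements *)

Lemma F2_addxx (x : 'F_2) : x + x = 0.
Proof. exact: addrr_pchar2 (pchar_Fp (isT : prime 2)) x. Qed.

Lemma F2_neq0 (x : 'F_2) : x != 0 -> x = 1.
Proof. by move=> x0; apply/eqP; case: x x0 => [[|[|]]]. Qed.

(** * The symplectic form, triangular symplectic matrices and Eichler transformations *)

Section SymplecticMatrices.
Variable m : nat.
Implicit Types (M S : 'M['F_2]_(m + m)) (x y p : 'I_(m + m)).

Definition conj_ord x : 'I_(m + m) :=
  match fintype.split x with inl i => rshift m i | inr i => lshift m i end.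

(* The order e_1 < ... < e_m < f_m < ... < f_1, for which the Borel group is
   the group of upper triangular symplectic matrices. *)
Definition pos x : nat :=
  match fintype.split x with inl i => i : nat | inr i => ((m + m).-1 - i)%N end.

Lemma conj_lshift i : conj_ord (lshift m i) = rshift m i.
Proof. by rewrite /conj_ord (unsplitK (inl i)). Qed.

Lemma conj_rshift i : conj_ord (rshift m i) = lshift m i.
Proof. by rewrite /conj_ord (unsplitK (inr i)). Qed.

Lemma pos_lshift i : pos (lshift m i) = i.
Proof. by rewrite /pos (unsplitK (inl i)). Qed.

Lemma pos_rshift i : pos (rshift m i) = ((m + m).-1 - i)%N.
Proof. by rewrite /pos (unsplitK (inr i)). Qed.

Definition conjE := (conj_lshift, conj_rshift, pos_lshift, pos_rshift).

Lemma conj_ordK : involutive conj_ord.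
Proof. by move=> x; case: (split_ordP x) => i ->; rewrite !conjE. Qed.

Lemma conj_ord_neq x : (conj_ord x == x) = false.
Proof.
by case: (split_ordP x) => i ->; rewrite !conjE ?eq_rlshift ?eq_lrshift.
Qed.

Lemma conj_ord_eq x y : (conj_ord x == y) = (x == conj_ord y).
Proof. exact: inv_eq conj_ordK x y. Qed.

Lemma pos_conj x : pos (conj_ord x) = ((m + m).-1 - pos x)%N.
Proof.
case: (split_ordP x) => i ->; rewrite !conjE //.
by have := ltn_ord i; lia.
Qed.

Lemma pos_lt x : (pos x < m + m)%N.
Proof. by case: (split_ordP x) => i ->; rewrite !conjE; have := ltn_ord i; lia. Qed.

Lemma pos_inj : injective pos.
Proof.
move=> x y; case: (split_ordP x) => i ->; case: (split_ordP y) => j ->;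
  rewrite !conjE; have := ltn_ord i; have := ltn_ord j => hi hj H.
- by congr lshift; apply: val_inj.
- by lia.
- by lia.
- by congr rshift; apply: val_inj => /=; lia.
Qed.

Lemma sympl_formE x y : sympl_form m x y = (y == conj_ord x)%:R.
Proof.
case: (split_ordP x) => i ->; case: (split_ordP y) => j ->; rewrite !conjE.
- by rewrite block_mxEul mxE eq_lrshift.
- by rewrite block_mxEur mxE eq_rshift eq_sym.
- by rewrite block_mxEdl mxE eq_lshift eq_sym.
- by rewrite block_mxEdr mxE eq_rlshift.
Qed.

Lemma sympl_mulE k (M : 'M['F_2]_(m + m, k)) x j :
  (sympl_form m *m M) x j = M (conj_ord x) j.
Proof.
rewrite mxE (bigD1 (conj_ord x)) //= sympl_formE eqxx mul1r big1 ?addr0 // => y.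
by rewrite sympl_formE => /negbTE ->; rewrite mul0r.
Qed.

Lemma mul_symplE k (M : 'M['F_2]_(k, m + m)) i y :
  (M *m sympl_form m) i y = M i (conj_ord y).
Proof.
rewrite mxE (bigD1 (conj_ord y)) //= sympl_formE conj_ordK eqxx mulr1.
rewrite big1 ?addr0 // => x; rewrite sympl_formE -conj_ord_eq eq_sym.
by rewrite conj_ord_eq eq_sym => /negbTE ->; rewrite mulr0.
Qed.

Lemma sympl_form_sq : sympl_form m *m sympl_form m = 1%:M.
Proof.
apply/matrixP => x y; rewrite sympl_mulE sympl_formE conj_ordK mxE.
by rewrite eq_sym.
Qed.

Definition symplectic M := M^T *m sympl_form m *m M == sympl_form m.

Lemma sympl_mulVmx M : symplectic M -> sympl_form m *m M^T *m sympl_form m *m M = 1%:M.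
Proof. by move=> /eqP MJ; rewrite -2!mulmxA (mulmxA M^T) MJ sympl_form_sq. Qed.

Lemma sympl_unit M : symplectic M -> M \in unitmx.
Proof. by move=> /sympl_mulVmx/mulmx1_unit[]. Qed.

Lemma sympl_inv M : symplectic M -> invmx M = sympl_form m *m M^T *m sympl_form m.
Proof.
move=> spM; have uM := sympl_unit spM.
by rewrite -[LHS]mul1mx -(sympl_mulVmx spM) mulmxK.
Qed.

Lemma sympl_tr M : symplectic M -> symplectic M^T.
Proof.
move=> spM; have := mulmx1C (sympl_mulVmx spM); rewrite !mulmxA => H.
by rewrite /symplectic trmxK -[_ *m M^T]mulmx1 -sympl_form_sq !mulmxA H mul1mx.
Qed.

Lemma sympl1 : symplectic 1%:M.
Proof. by rewrite /symplectic trmx1 mul1mx mulmx1. Qed.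

Lemma symplM M S : symplectic M -> symplectic S -> symplectic (M *m S).
Proof.
move=> /eqP spM /eqP spS; apply/eqP.
by rewrite trmx_mul !mulmxA -[_ *m M]mulmxA -(mulmxA S^T) (mulmxA M^T) mulmxA -(mulmxA S^T) spM.
Qed.

Lemma symplV M : symplectic M -> symplectic (invmx M).
Proof.
move=> spM; have uM := sympl_unit spM; apply/eqP.
by rewrite -[in LHS](eqP spM) trmx_inv !mulmxA mulVmx ?unitmx_tr // mul1mx mulmxK.
Qed.

(** When column [x] is the unit vector at [y], row [x] of S^T J S is just row [conj_ord y] of [S],
    and the relation S^T J S = J prescribes it. *)
Lemma sympl_col_unit S x y : symplectic S ->
  (forall i, S i x = (i == y)%:R) ->
  forall j, S (conj_ord y) j = (j == conj_ord x)%:R.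
Proof.
move=> /eqP spS Sx j; rewrite -sympl_formE -spS -mulmxA mxE (bigD1 y) //= mxE.
rewrite Sx eqxx mul1r sympl_mulE big1 ?addr0 // => i /negbTE niy.
by rewrite mxE Sx niy mul0r.
Qed.

Lemma sympl_row_unit S x y : symplectic S ->
  (forall j, S y j = (j == x)%:R) ->
  forall i, S i (conj_ord x) = (i == conj_ord y)%:R.
Proof.
move=> spS Sy i; rewrite -(sympl_col_unit (sympl_tr spS) (y := x) (x := y)) ?mxE //.
by move=> j; rewrite mxE.
Qed.

Definition upper_tri M := [forall x, forall y, (pos y < pos x)%N ==> (M x y == 0)].

Lemma upper_triP M :
  reflect (forall x y, (pos y < pos x)%N -> M x y = 0) (upper_tri M).
Proof.
apply: (iffP forallP) => [H x y lt_yx|H x].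
  by move/forallP/(_ y): (H x) => /implyP/(_ lt_yx)/eqP.
by apply/forallP => y; apply/implyP => /H ->.
Qed.

Definition sympl_borel M := symplectic M && upper_tri M.

Lemma upper_tri1 : upper_tri 1%:M.
Proof. by apply/upper_triP => x y; rewrite mxE; case: eqVneq => // ->; rewrite ltnn. Qed.

Lemma upper_triM M S : upper_tri M -> upper_tri S -> upper_tri (M *m S).
Proof.
move=> /upper_triP tM /upper_triP tS; apply/upper_triP => x y lt_yx.
rewrite mxE big1 // => z _; case: (ltnP (pos z) (pos x)) => [/tM ->|].
  by rewrite mul0r.
by move/(leq_trans lt_yx)/tS => ->; rewrite mulr0.
Qed.

Lemma sympl_borel1 : sympl_borel 1%:M.
Proof. by rewrite /sympl_borel sympl1 upper_tri1. Qed.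

Lemma sympl_borelM M S : sympl_borel M -> sympl_borel S -> sympl_borel (M *m S).
Proof.
by move=> /andP[? ?] /andP[? ?]; rewrite /sympl_borel symplM ?upper_triM.
Qed.

(** The inverse is J M^T J. Transposition exchanges upper and lower triangular matrices, and so does
    conjugation by J, which reverses [pos]. *)
Lemma sympl_borelV M : sympl_borel M -> sympl_borel (invmx M).
Proof.
move=> /andP[spM /upper_triP tM]; rewrite /sympl_borel symplV //=.
apply/upper_triP => x y lt_yx; rewrite sympl_inv // mul_symplE sympl_mulE mxE.
by rewrite tM // !pos_conj; have := pos_lt x; lia.
Qed.

(* x |-> x + B(x,f) w + B(x,w) f + B(w,e_p) B(x,f) f, where f is the conjugate
   of e_p and w = v - e_p; for v_p = 1 it is
   symplectic and exchanges v and e_p. *)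
Definition eichler (p : 'I_(m + m)) (v : 'I_(m + m) -> 'F_2) : 'M['F_2]_(m + m) :=
  let w x := v x + (x == p)%:R in
  \matrix_(x, y) ((x == y)%:R + w x * (y == p)%:R
    + (x == conj_ord p)%:R * (w (conj_ord y) + w (conj_ord p) * (y == p)%:R)).

(** The form is alternating: the terms at [x] and [conj_ord x] coincide and cancel in characteristic
    two. *)
Lemma sum_conj_ord (w : 'I_(m + m) -> 'F_2) : \sum_x w x * w (conj_ord x) = 0.
Proof.
rewrite big_split_ord /= -[RHS](F2_addxx (\sum_(i < m) w (lshift m i) * w (rshift m i))).
congr (_ + _); apply: eq_bigr => i _; rewrite !conjE //.
by rewrite mulrC.
Qed.

Lemma sum_delta (f : 'I_(m + m) -> 'F_2) x : \sum_y (x == y)%:R * f y = f x.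
Proof.
rewrite (bigD1 x) //= eqxx mul1r big1 ?addr0 // => y /negbTE nyx.
by rewrite eq_sym nyx mul0r.
Qed.

Lemma sum_delta' (f : 'I_(m + m) -> 'F_2) x : \sum_y (y == x)%:R * f y = f x.
Proof. by under eq_bigr do rewrite eq_sym; rewrite sum_delta. Qed.

Lemma eichler_mul p v (f : 'I_(m + m) -> 'F_2) x :
  let w x := v x + (x == p)%:R in
  \sum_y eichler p v x y * f y = f x + w x * f p
    + (x == conj_ord p)%:R * (\sum_y w (conj_ord y) * f y + w (conj_ord p) * f p).
Proof.
move=> w; transitivity (\sum_y ((x == y)%:R * f y + w x * ((y == p)%:R * f y)
   + (x == conj_ord p)%:R * (w (conj_ord y) * f y + w (conj_ord p) * ((y == p)%:R * f y)))).
  apply: eq_bigr => y _; rewrite mxE -/(w x) -/(w (conj_ord y)) -/(w (conj_ord p)).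
  move: (x == y)%:R (y == p)%:R (x == conj_ord p)%:R (f y) (w x) (w _) (w _) => a b c d e g h.
  by ring.
by rewrite !big_split /= -!mulr_sumr sum_delta big_split /= -!mulr_sumr !sum_delta'.
Qed.

(** Since B(v,v) = 0, the coefficient of f is twice the entry of [v] at [conj_ord p], so it vanishes
    and leaves v + w = e_p. *)
Lemma eichler_vec p v x : v p = 1 ->
  \sum_y eichler p v x y * v y = (x == p)%:R.
Proof.
move=> vp; rewrite eichler_mul vp !mulr1.
have -> : \sum_y (v (conj_ord y) + (conj_ord y == p)%:R) * v y = v (conj_ord p).
  under eq_bigr => y _ do rewrite mulrDl conj_ord_eq mulrC.
  by rewrite big_split /= sum_conj_ord add0r sum_delta'.
by rewrite conj_ord_neq mulr0n addr0 F2_addxx mulr0 addr0 addrA F2_addxx add0r.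
Qed.

(** The vector e_y is orthogonal to both w and f, hence fixed. In the elimination this protects the
    columns cleared earlier. *)
Lemma eichler_fix p v x y : v p = 1 -> y != p -> v (conj_ord y) = 0 ->
  eichler p v x y = (x == y)%:R.
Proof.
move=> vp /negbTE yp vy; rewrite mxE yp mulr0n !mulr0 !addr0 vy add0r.
case: (eqVneq (conj_ord y) p) => [E|_]; last by rewrite mulr0n mulr0 addr0.
by have := oner_neq0 'F_2; rewrite -vp -E vy eqxx.
Qed.

(** Vectors are changed only by multiples of w and f, and both vanish at [y]. *)
Lemma eichler_row p v x y : v p = 1 -> v y = 0 -> y != conj_ord p ->
  eichler p v y x = (x == y)%:R.
Proof.
move=> vp vy /negbTE yp; rewrite mxE yp mulr0n mul0r addr0 vy add0r eq_sym.
case: (eqVneq y p) => [E|_]; last by rewrite mulr0n mul0r addr0.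
by have := oner_neq0 'F_2; rewrite -vp -E vy eqxx.
Qed.

(* [eichler p v] is [1 + Q] with [Q^2 = 0] and [J Q] symmetric. *)
Lemma eichler_sympl p v : v p = 1 -> symplectic (eichler p v).
Proof.
move=> vp; pose w x := v x + (x == p)%:R.
have wp : w p = 0 by rewrite /w vp eqxx F2_addxx.
pose Q := eichler p v + 1%:M.
have QE x y : Q x y = w x * (y == p)%:R
    + (x == conj_ord p)%:R * (w (conj_ord y) + w (conj_ord p) * (y == p)%:R).
  by rewrite !mxE -[RHS]add0r -[X in _ = X + _](F2_addxx (x == y)%:R) [LHS]addrC -!addrA.
have EQ : eichler p v = 1%:M + Q.
  apply/matrixP => x y; rewrite /Q [RHS]mxE [X in _ + X]mxE [1%:M x y]mxE.
  by rewrite addrCA F2_addxx addr0.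
have QQ : Q *m Q = 0.
  apply/matrixP => x z; rewrite !mxE.
  (* Q Q is computed as E Q + Q with E = [eichler p v]. Row [p] of Q is zero because w and f vanish
     at [p]. *)
  transitivity (\sum_y (eichler p v x y * Q y z + (x == y)%:R * Q y z)).
    by apply: eq_bigr => y _; rewrite [Q x y]mxE mulrDl [1%:M x y]mxE.
  rewrite big_split /= sum_delta eichler_mul -/(w x).
  have Qpz : Q p z = 0.
    by rewrite QE wp mul0r add0r eq_sym conj_ord_neq mulr0n mul0r.
  rewrite Qpz !mulr0 !addr0 addrAC F2_addxx add0r.
  rewrite [X in _ * X](_ : _ = 0) ?mulr0 //.
  under eq_bigr => y _ do rewrite QE mulrDr !mulrA (mulrC (w (conj_ord y))).
  rewrite big_split /= -mulr_suml sum_conj_ord mul0r add0r.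
  under eq_bigr => y _ do rewrite (mulrC (w (conj_ord y))) -mulrA.
  by rewrite sum_delta' conj_ordK wp mul0r.
have JQ : Q^T *m sympl_form m = sympl_form m *m Q.
  apply/matrixP => x y; rewrite mul_symplE sympl_mulE mxE !QE.
  rewrite !(inj_eq (inv_inj (@conj_ordK))).
  move: (x == p)%:R (y == p)%:R (w _) (w _) (w _) => a b c d e.
  by ring.
apply/eqP; rewrite EQ; clearbody Q.
have -> : (1%:M + Q)^T = 1%:M + Q^T by rewrite -[in RHS]trmx1 -raddfD.
(* The expansion of (1 + Q)^T J (1 + Q) is J + 2 J Q + J Q^2. *)
rewrite mulmxDl mul1mx JQ mulmxDl !mulmxDr !mulmx1.
rewrite -[_ *m Q *m Q]mulmxA QQ mulmx0 addr0 -addrA.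
suff -> : sympl_form m *m Q + sympl_form m *m Q = 0 by rewrite addr0.
by apply/matrixP => x y; rewrite [LHS]mxE [RHS]mxE F2_addxx.
Qed.

(** With [p] last in the support of [v], w lives strictly before [p], and every correction to the
    identity lands above the diagonal. *)
Lemma eichler_upper p v : v p = 1 ->
  (forall x, v x != 0 -> (pos x <= pos p)%N) -> upper_tri (eichler p v).
Proof.
move=> vp le_p; apply/upper_triP => x y lt_yx.
have vE z : (pos p < pos z)%N -> v z = 0.
  by move=> lt_pz; apply: contraTeq lt_pz => /le_p; rewrite -leqNgt.
have wE z : (pos p <= pos z)%N -> v z + (z == p)%:R = 0.
  rewrite leq_eqVlt => /orP[/eqP/pos_inj <-|lt_pz]; first by rewrite eqxx vp F2_addxx.
  rewrite vE // add0r; case: eqVneq lt_pz => // ->; by rewrite ltnn.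
rewrite mxE; have -> : (x == y)%:R = 0 :> 'F_2; first suff -> : (x == y) = false by [].
  by apply: contraTF lt_yx => /eqP ->; rewrite ltnn.
rewrite add0r; have -> : (v x + (x == p)%:R) * (y == p)%:R = 0.
  case: (eqVneq y p) => [E|_]; last by rewrite mulr0n mulr0.
  by rewrite wE ?mul0r // -E ltnW.
rewrite add0r; case: (eqVneq x (conj_ord p)) => [E|_]; last by rewrite mulr0n mul0r.
rewrite mul1r wE ?add0r; last by move: lt_yx; rewrite E !pos_conj; lia.
case: (eqVneq y p) => [Ey|_]; last by rewrite mulr0n mulr0.
by rewrite -E wE ?mul0r // -Ey ltnW.
Qed.

(** Mirror image of [eichler_upper], with [p] first in the support of [v]. The transpose serves as
    right factor in the elimination. *)
Lemma eichler_lower p v : v p = 1 ->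
  (forall x, v x != 0 -> (pos p <= pos x)%N) -> upper_tri (eichler p v)^T.
Proof.
move=> vp le_p; apply/upper_triP => y x lt_xy; rewrite mxE.
have vE z : (pos z < pos p)%N -> v z = 0.
  by move=> lt_pz; apply: contraTeq lt_pz => /le_p; rewrite -leqNgt.
have wE z : (pos z <= pos p)%N -> v z + (z == p)%:R = 0.
  rewrite leq_eqVlt => /orP[/eqP/pos_inj ->|lt_pz]; first by rewrite eqxx vp F2_addxx.
  rewrite vE // add0r; case: eqVneq lt_pz => // ->; by rewrite ltnn.
rewrite mxE; have -> : (x == y)%:R = 0 :> 'F_2; first suff -> : (x == y) = false by [].
  by apply: contraTF lt_xy => /eqP ->; rewrite ltnn.
rewrite add0r; have -> : (v x + (x == p)%:R) * (y == p)%:R = 0.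
  case: (eqVneq y p) => [E|_]; last by rewrite mulr0n mulr0.
  by rewrite wE ?mul0r // -E ltnW.
rewrite add0r; case: (eqVneq x (conj_ord p)) => [E|_]; last by rewrite mulr0n mul0r.
rewrite mul1r wE ?add0r; last by move: lt_xy; rewrite E !pos_conj; have := pos_lt y; lia.
case: (eqVneq y p) => [Ey|_]; last by rewrite mulr0n mulr0.
by rewrite -E wE ?mul0r // -Ey ltnW.
Qed.

End SymplecticMatrices.

(** * Reduction of a symplectic matrix to unit columns by Borel factors *)

Section Elimination.
Variable m : nat.
Implicit Types (M S : 'M['F_2]_(m + m)) (x y p : 'I_(m + m)).

(* The basis vectors e_i and f_i with i < k. *)
Definition processed k x := (pos x < k)%N || (pos (conj_ord x) < k)%N.

Lemma processed_conj k x : processed k (conj_ord x) = processed k x.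
Proof. by rewrite /processed conj_ordK orbC. Qed.

Lemma processedS k (lt_km : (k < m)%N) x : processed k.+1 x ->
  [\/ processed k x, x = lshift m (Ordinal lt_km) | x = rshift m (Ordinal lt_km)].
Proof.
have kE y : pos y = k -> y = lshift m (Ordinal lt_km).
  by move=> yk; apply: pos_inj; rewrite conjE.
rewrite /processed !ltnS (leq_eqVlt (pos x)) (leq_eqVlt (pos (conj_ord x))) => /orP[] /orP[|lt_k].
- by move=> /eqP/kE ->; constructor 2.
- by constructor 1; rewrite lt_k.
- by move=> /eqP/kE E; constructor 3; rewrite -[x]conj_ordK E conjE.
- by constructor 1; rewrite lt_k orbT.
Qed.

Lemma processed_lshift k (lt_km : (k < m)%N) : processed k (lshift m (Ordinal lt_km)) = false.
Proof. by rewrite /processed !conjE /= ltnn /=; apply/negbTE; lia. Qed.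

Lemma processed_all x : processed m x.
Proof.
by rewrite /processed; case: (split_ordP x) => i ->; rewrite !conjE ltn_ord ?orbT.
Qed.

Definition unit_col (S : 'M['F_2]_(m + m)) x y := forall i, S i x = (i == y)%:R.

Lemma unit_col_inj S x y z : unit_col S x y -> S z x = 1 -> z = y.
Proof. by move=> -> ; case: eqVneq => // _ /eqP; rewrite eq_sym oner_eq0. Qed.

Lemma elimination_step k S : (k < m)%N -> symplectic S ->
    (forall x, processed k x -> exists y, unit_col S x y) ->
  exists b1 b2, [/\ sympl_borel b1, sympl_borel b2 &
    forall x, processed k.+1 x -> exists y, unit_col (b1 *m S *m b2) x y].
Proof.
move=> lt_km spS unitS; pose p0 := lshift m (Ordinal lt_km).
have p0k : processed k p0 = false by apply: processed_lshift.
(* The partner of a cleared column is a unit column too, and [sympl_col_unit] turns it into a unit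
   row. *)
have rowS x y : processed k x -> unit_col S x y ->
    forall j, S y j = (j == x)%:R.
  move=> xk Sxy; have xk' : processed k (conj_ord x) by rewrite processed_conj.
  have [y' Sxy'] := unitS _ xk'.
  have rowy' j : S (conj_ord y') j = (j == x)%:R.
    by rewrite (sympl_col_unit spS Sxy') conj_ordK.
  suff <- : conj_ord y' = y by [].
  by apply: unit_col_inj Sxy _; rewrite rowy' eqxx.
pose v i := S i p0.
(* The pivot rows of cleared columns are unit vectors supported on cleared columns, so the new
   column meets them in zero. *)
have v0 x y : processed k x -> unit_col S x y -> v y = 0.
  move=> xk Sxy; rewrite /v (rowS _ _ xk Sxy); case: eqVneq => // E.
  by rewrite -E p0k in xk.
have v0' x y : processed k x -> unit_col S x y -> v (conj_ord y) = 0.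
  move=> xk Sxy; apply: (v0 (conj_ord x)); first by rewrite processed_conj.
  exact: sympl_row_unit spS (rowS _ _ xk Sxy).
(* If column [p0] were zero, so would be row [p0] of S^T J S = J, whose entry at [conj_ord p0] is
   1. *)
have [q vq] : exists q, v q != 0.
  apply/existsP; apply: contraT; rewrite negb_exists => /forallP v_eq0.
  have /eqP/matrixP/(_ p0 (conj_ord p0)) := spS.
  rewrite sympl_formE eqxx -mulmxA mxE big1.
    by move=> /eqP; rewrite eq_sym oner_eq0.
  by move=> i _; rewrite mxE -/(v i); move: (v_eq0 i); rewrite negbK => /eqP ->; rewrite mul0r.
(* The last nonzero entry is taken as pivot, as [eichler_upper] requires. *)
case: (@arg_maxnP _ q (fun i => v i != 0) (@pos m) vq) => p /F2_neq0 vp max_p {q vq}.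
pose E := eichler p v; pose S1 := E *m S.
have bE : sympl_borel E.
  by rewrite /sympl_borel eichler_sympl //= eichler_upper.
have spS1 : symplectic S1 by apply: symplM => //; case/andP: bE.
have S1p0 : unit_col S1 p0 p by move=> i; rewrite mxE eichler_vec.
have unitS1 x y : processed k x -> unit_col S x y -> unit_col S1 x y.
  move=> xk Sxy i; rewrite mxE.
  under eq_bigr => j _ do rewrite Sxy mulrC.
  rewrite sum_delta' eichler_fix //; last exact: v0' Sxy.
  by apply: contra_eqN (v0 _ _ xk Sxy) => /eqP ->; rewrite vp oner_eq0.
(* Next the pivot row is cleared. It vanishes on the cleared columns, so [p0] comes first in its
   support and [eichler_lower] applies. *)
pose r j := S1 p j.
have rp0 : r p0 = 1 by rewrite /r S1p0 eqxx.
have r0 x : processed k x -> r x = 0.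
  move=> xk; have [y Sxy] := unitS _ xk.
  rewrite /r (unitS1 _ _ xk Sxy); case: eqVneq => // pE.
  by move: (v0 _ _ xk Sxy) => /eqP; rewrite -pE vp oner_eq0.
pose E' := eichler p0 r; pose S2 := S1 *m E'^T.
have bE' : sympl_borel E'^T.
  rewrite /sympl_borel sympl_tr ?eichler_sympl //= eichler_lower // => x.
  rewrite pos_lshift /= => rx; apply: contraNT rx; rewrite -ltnNge => lt_xk.
  by rewrite r0 // /processed lt_xk.
have spS2 : symplectic S2 by apply: symplM => //; case/andP: bE'.
have S2p j : S2 p j = (j == p0)%:R.
  rewrite mxE -(eichler_vec _ rp0); apply: eq_bigr => i _.
  by rewrite [E'^T i j]mxE mulrC.
have colS2 x i : (forall l, E' x l = (l == x)%:R) -> S2 i x = S1 i x.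
  move=> E'x; rewrite mxE; under eq_bigr => j _ do rewrite [E'^T j x]mxE E'x mulrC.
  by rewrite sum_delta'.
(* Multiplication by [E'^T] on the right keeps column [p0], since w and f for [r] vanish at [p0]. *)
have E'p0 l : E' p0 l = (l == p0)%:R.
  rewrite /E' mxE rp0 eqxx F2_addxx mul0r addr0 eq_sym.
  by rewrite [p0 == conj_ord _]eq_sym conj_ord_neq mulr0n mul0r addr0.
exists E, E'^T; split=> // x /(processedS lt_km)[xk | -> | ->]; rewrite -/S1 -/S2.
- have [y Sxy] := unitS _ xk; exists y => i; rewrite colS2; first exact: (unitS1 x y).
  move=> l.
  have xp0 : x != conj_ord p0.
    by apply: contraTneq xk => ->; rewrite processed_conj p0k.
  exact: eichler_row rp0 (r0 _ xk) xp0.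
- by exists p => i; rewrite colS2.
(* Row [p] is now the unit vector at [p0], which forces the column f_k to be a unit vector. *)
- rewrite -conj_lshift; exists (conj_ord p); exact: sympl_row_unit.
Qed.

Lemma elimination S : symplectic S ->
  exists b1 b2, [/\ sympl_borel b1, sympl_borel b2 &
    forall x, exists y, unit_col (b1 *m S *m b2) x y].
Proof.
move=> spS; suff H k : (k <= m)%N -> exists b1 b2, [/\ sympl_borel b1, sympl_borel b2 &
    forall x, processed k x -> exists y, unit_col (b1 *m S *m b2) x y].
  have [b1 [b2 [? ? ?]]] := H m (leqnn m).
  by exists b1, b2; split=> // x; have := processed_all x; auto.
elim: k => [|k IHk] le_km.
  by exists 1%:M, 1%:M; rewrite sympl_borel1; split=> // x; rewrite /processed !ltn0.
have [b1 [b2 [bb1 bb2 unitS]]] := IHk (ltnW le_km).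
have spbSb : symplectic (b1 *m S *m b2).
  by rewrite !symplM //; [case/andP: bb1 | case/andP: bb2].
have [c1 [c2 [bc1 bc2 H]]] := elimination_step le_km spbSb unitS.
exists (c1 *m b1), (b2 *m c2); rewrite !sympl_borelM //; split=> // x /H.
by rewrite !mulmxA.
Qed.

End Elimination.

(** * Permutations commuting with the exchange of e_k and f_k, and their generators *)

Section SignedPermutations.
Variable m : nat.
Implicit Types (M S : 'M['F_2]_(m + m)) (x y p : 'I_(m + m)) (s : 'S_(m + m)).

Definition conj_perm s := [forall x, s (conj_ord x) == conj_ord (s x)].

Lemma conj_permP s :
  reflect (forall x, s (conj_ord x) = conj_ord (s x)) (conj_perm s).
Proof. exact: 'forall_eqP. Qed.

Lemma conj_perm1 : conj_perm 1.
Proof. by apply/conj_permP => x; rewrite !perm1. Qed.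

Lemma conj_permM s t : conj_perm s -> conj_perm t -> conj_perm (s * t).
Proof.
move=> /conj_permP cs /conj_permP ct; apply/conj_permP => x.
by rewrite !permM cs ct.
Qed.

Lemma conj_permV s : conj_perm s -> conj_perm s^-1.
Proof.
move=> /conj_permP cs; apply/conj_permP => x; apply: (@perm_inj _ s).
by rewrite cs !permKV.
Qed.

Lemma sympl_perm_mx s : conj_perm s -> symplectic (perm_mx s).
Proof.
move=> /conj_permP cs; apply/eqP/matrixP => x y.
rewrite tr_perm_mx -mulmxA -row_permE mxE sympl_mulE sympl_formE mxE mxE.
by rewrite cs permKV eq_sym.
Qed.

(** Partner columns yield unit rows, so the pivot map is injective; the symplectic relation makes it
    commute with [conj_ord]. *)
Lemma unit_cols_perm_mx S : symplectic S -> (forall x, exists y, unit_col S x y) ->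
  exists2 s, conj_perm s & S = perm_mx s.
Proof.
move=> spS /fin_all_exists[f Sf].
have rowS x j : S (f x) j = (j == x)%:R.
  have rowx i : S (conj_ord (f (conj_ord x))) i = (i == x)%:R.
    by rewrite (sympl_col_unit spS (Sf _)) conj_ordK.
  suff <- : conj_ord (f (conj_ord x)) = f x by [].
  by apply: unit_col_inj (Sf x) _; rewrite rowx eqxx.
have f_inj : injective f.
  move=> x y fxy; have := rowS x y; rewrite fxy rowS eqxx.
  by case: eqVneq => // _ /eqP; rewrite oner_eq0.
have fC x : f (conj_ord x) = conj_ord (f x).
  rewrite -[LHS]conj_ordK; congr conj_ord.
  apply: unit_col_inj (Sf x) _.
  by rewrite (sympl_col_unit spS (Sf _)) conj_ordK eqxx.
(* The ones of [perm_mx s] are at (i, s i), whereas [f] sends columns to rows; hence the inverse. *)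
exists (perm f_inj)^-1%g.
  by apply/conj_permV/conj_permP => x; rewrite !permE.
apply/matrixP => i x; rewrite Sf !mxE; congr (_ : bool)%:R.
by rewrite -[RHS](inj_eq (@perm_inj _ (perm f_inj))) permKV permE.
Qed.

Definition qubit_fun (t : 'S_m) x :=
  match fintype.split x with inl i => lshift m (t i) | inr i => rshift m (t i) end.

Lemma qubit_lshift t i : qubit_fun t (lshift m i) = lshift m (t i).
Proof. by rewrite /qubit_fun (unsplitK (inl i)). Qed.

Lemma qubit_rshift t i : qubit_fun t (rshift m i) = rshift m (t i).
Proof. by rewrite /qubit_fun (unsplitK (inr i)). Qed.

Lemma qubit_fun_inj t : injective (qubit_fun t).
Proof.
apply: (can_inj (g := qubit_fun t^-1)) => x.
by case: (split_ordP x) => i ->; rewrite ?(qubit_lshift, qubit_rshift) permK.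
Qed.

Definition qubit_perm t : 'S_(m + m) := perm (@qubit_fun_inj t).

Lemma qubit_perm_mxE t : qubit_perm_mx t = perm_mx (qubit_perm t).
Proof.
apply/matrixP => x y; rewrite [RHS]mxE [RHS]mxE permE.
case: (split_ordP x) => i ->; case: (split_ordP y) => j ->;
  rewrite ?(qubit_lshift, qubit_rshift).
- by rewrite block_mxEul !mxE eq_lshift.
- by rewrite block_mxEur !mxE eq_lrshift.
- by rewrite block_mxEdl !mxE eq_rlshift.
- by rewrite block_mxEdr !mxE eq_rshift.
Qed.

Lemma conj_qubit_perm t : conj_perm (qubit_perm t).
Proof.
apply/conj_permP => x; rewrite !permE.
by case: (split_ordP x) => i ->; rewrite ?(conjE, qubit_lshift, qubit_rshift).
Qed.

Definition hadamard_perm k : 'S_(m + m) := tperm (lshift m k) (rshift m k).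

Lemma conj_hadamard_perm k : conj_perm (hadamard_perm k).
Proof.
apply/conj_permP => x; rewrite /hadamard_perm.
case: (split_ordP x) => i ->; rewrite !conjE; case: (eqVneq i k) => [->|ik].
- by rewrite tpermL tpermR conjE.
- by rewrite !tpermD ?conjE ?eq_shift // eq_sym.
- by rewrite tpermL tpermR conjE.
- by rewrite !tpermD ?conjE ?eq_shift // eq_sym.
Qed.

(** Generation by Hadamard gates and qubit permutations. Qubits are fixed one at a time: if [s]
    sends e_k to f_q, a Hadamard gate turns f_q into e_q, and exchanging the qubits k and q brings
    e_q to e_k. *)
Lemma conj_perm_ind (P : 'S_(m + m) -> Prop) :
  P 1%g -> (forall s t, P s -> P t -> P (s * t)%g) -> (forall s, P s -> P s^-1%g) ->
  (forall k, P (hadamard_perm k)) -> (forall t, P (qubit_perm t)) ->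
  forall s, conj_perm s -> P s.
Proof.
move=> P1 PM PV Ph Pq.
(* Here [d] counts the qubits not yet known to be fixed. *)
suff H d k s : (k + d = m)%N -> conj_perm s ->
    (forall x, processed k x -> s x = x) -> P s.
  by move=> s cs; apply: (H m 0%N s) => // x; rewrite /processed !ltn0.
elim: d k s => [|d IHd] k s kd cs fix_s.
  suff -> : s = 1%g by [].
  apply/permP => x; rewrite perm1 fix_s //.
  by move: kd; rewrite addn0 => ->; apply: processed_all.
have lt_km : (k < m)%N by lia.
pose k0 := Ordinal lt_km; pose p0 := lshift m k0.
(* Write s = (s t) t^-1; the product s t fixes e_k, and then f_k because it commutes with
   [conj_ord]. *)
have step t : conj_perm t -> P t -> (forall x, processed k x -> t x = x) ->
    t (s p0) = p0 -> P s.
  move=> ct Pt fix_t tsp0; rewrite -(mulgK t s); apply: PM; last exact: PV.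
  apply: (IHd k.+1); first by lia.
    exact: conj_permM.
  have stp0 : (s * t)%g p0 = p0 by rewrite permM.
  move=> x /(processedS lt_km)[xk|->|->] //; first by rewrite permM fix_s // fix_t.
  by rewrite -conj_lshift; move/conj_permP: (conj_permM cs ct) => ->; rewrite stp0.
have unproc_sp0 : processed k (s p0) = false.
  apply: contraFF (processed_lshift lt_km) => sk.
  by rewrite -/k0 -/p0 -(perm_inj (fix_s _ sk)).
have fix_lift q (t : 'S_m) : processed k (lshift m q) = false ->
    (forall i, i != k0 -> i != q -> t i = i) ->
    forall x, processed k x -> qubit_perm t x = x.
  move=> qk fix_t x xk; rewrite permE.
  have [i ix ik] : exists2 i, x = lshift m i \/ x = rshift m i & processed k (lshift m i).
    case: (split_ordP x) xk => i -> xk; exists i; auto.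
    by rewrite -processed_conj conjE.
  have ti : t i = i.
    apply: fix_t; first by apply: contraTneq ik => ->; rewrite processed_lshift.
    by apply: contraTneq ik => ->; rewrite qk.
  by case: ix => ->; rewrite ?(qubit_lshift, qubit_rshift) ti.
case: (split_ordP (s p0)) => q sp0; rewrite sp0 in step unproc_sp0.
  apply: (step (qubit_perm (tperm k0 q))) => //.
  - exact: conj_qubit_perm.
  - by apply: (fix_lift q) => // i ik iq; rewrite tpermD // eq_sym.
  - by rewrite permE qubit_lshift tpermR.
have qk : processed k (lshift m q) = false by rewrite -processed_conj conjE.
apply: (step (hadamard_perm q * qubit_perm (tperm k0 q))%g).
- by apply: conj_permM; [apply: conj_hadamard_perm | apply: conj_qubit_perm].
- exact: PM.
- move=> x xk; rewrite permM tpermD.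
  + by apply: (fix_lift q) => // i ik iq; rewrite tpermD // eq_sym.
  + by apply: contraTneq xk => <-; rewrite qk.
  + by apply: contraTneq xk => <-; rewrite unproc_sp0.
- by rewrite permM tpermR permE qubit_lshift tpermR.
Qed.

End SignedPermutations.

(** * The Borel group: triangular form and cardinality *)

Lemma trig_invmx (F : fieldType) m (L : 'M[F]_m) :
  L \in unitmx -> is_trig_mx L -> is_trig_mx (invmx L).
Proof.
move=> uL trL; have diagL i : L i i != 0.
  by move: uL; rewrite unitmxE unitfE (det_trig trL) => /prodf_neq0; apply.
move/is_trig_mxP: trL => trL; apply/is_trig_mxP => i.
have [k] := ubnP (i : nat); elim: k i => // k IHk i le_ik j lt_ij.
(* In the entry (i, j) of L L^-1 = 1, terms with l < i vanish by induction and terms with l > i by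
   triangularity of [L]. *)
have /matrixP/(_ i j) := mulmxV uL; rewrite !mxE (bigD1 i) //= big1 ?addr0.
  have /negPf -> : i != j by apply: contraTneq lt_ij => ->; rewrite ltnn.
  by move=> /eqP; rewrite mulf_eq0 (negPf (diagL i)) => /eqP.
move=> l; rewrite neq_ltn => /orP[lt_li|/trL ->]; last by rewrite mul0r.
by rewrite IHk ?mulr0 //; [apply: leq_trans lt_li _ | apply: ltn_trans lt_ij].
Qed.

Section BorelCard.
Variable m : nat.
Implicit Types (M : 'M['F_2]_(m + m)) (A C Q : 'M['F_2]_m).

Lemma upper_tri_block A X D : upper_tri (block_mx A X 0 D) = is_trig_mx A^T && is_trig_mx D.
Proof.
apply/upper_triP/andP => [H|[/is_trig_mxP tA /is_trig_mxP tD] x y].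
  split; apply/is_trig_mxP => i j lt_ij.
    by rewrite mxE -(block_mxEul A X 0 D) H // !conjE.
  rewrite -(block_mxEdr A X 0 D) H // !conjE.
  by have := ltn_ord i; have := ltn_ord j; lia.
case: (split_ordP x) => i ->; case: (split_ordP y) => j ->; rewrite !conjE.
- by rewrite block_mxEul => /tA; rewrite mxE.
- by have := ltn_ord i; have := ltn_ord j; lia.
- by rewrite block_mxEdl mxE.
- by rewrite block_mxEdr => H; apply: tD; lia.
Qed.

Lemma sympl_block A X D : symplectic (block_mx A X 0 D) =
  (A^T *m D == 1%:M) && (D^T *m X + X^T *m D == 0).
Proof.
rewrite /symplectic /sympl_form tr_block_mx !mulmx_block trmx0.
rewrite !(mul0mx, mulmx0, mulmx1, mul1mx, add0r, addr0).
apply/eqP/andP => [/eq_block_mx[_ -> _ ->]|[/eqP AD /eqP ->]] //.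
by rewrite AD -[D^T *m A]trmxK trmx_mul trmxK AD trmx1.
Qed.

Lemma mx_F2_addxx n k (N : 'M['F_2]_(n, k)) : N + N = 0.
Proof. by apply/matrixP => i j; rewrite !mxE F2_addxx. Qed.

Lemma borel_mul A C : block_mx A 0 0 (invmx A^T) *m block_mx 1%:M C 0 1%:M =
  block_mx A (A *m C) 0 (invmx A^T).
Proof. by rewrite mulmx_block !(mul0mx, mulmx0, mulmx1, add0r, addr0). Qed.

(** Triangularity kills the lower left block. The symplectic relation then says that D = (A^T)^-1
    and, in characteristic two, that A^-1 X is symmetric. As [pos] lists the f's backwards, D must
    be lower triangular, which agrees with A being upper triangular. *)
Lemma borel_mxE M : borel_mx M = sympl_borel M.
Proof.
apply/existsP/idP => [[A /existsP[C /and4P[uA tA /eqP sC /eqP ->]]]|].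
  have uAt : A^T \in unitmx by rewrite unitmx_tr.
  rewrite borel_mul /sympl_borel upper_tri_block tA trig_invmx // sympl_block.
  rewrite mulmxV // eqxx trmx_mul trmx_inv trmxK mulmxA mulVmx // mul1mx.
  by rewrite -mulmxA mulmxV // mulmx1 -sC mx_F2_addxx eqxx.
rewrite -[M]submxK; set A := ulsubmx M; set X := ursubmx M; set D := drsubmx M.
move=> bM; have dl0 : dlsubmx M = 0.
  case/andP: bM => _ /upper_triP tM; apply/matrixP => i j.
  rewrite -(block_mxEdl A X (dlsubmx M) D) tM ?mxE // !conjE.
  by have := ltn_ord i; have := ltn_ord j; lia.
move: bM; rewrite dl0 /sympl_borel sympl_block upper_tri_block.
case/andP=> /andP[/eqP AD /eqP XD] /andP[tA tD].
have [uAt _] := mulmx1_unit AD; have uA : A \in unitmx by rewrite -unitmx_tr.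
have DE : D = invmx A^T by rewrite -[LHS]mul1mx -(mulVmx uAt) -mulmxA AD mulmx1.
exists A; apply/existsP; exists (invmx A *m X).
rewrite borel_mul mulmxA mulmxV // mul1mx -DE uA tA eqxx andbT /=.
move: XD; rewrite DE trmx_inv trmxK trmx_mul trmx_inv => /eqP.
by rewrite addr_eq0 (addr0_eq (mx_F2_addxx _)).
Qed.

(* The strictly lower part of an arbitrary matrix encodes a unipotent upper
   triangular matrix, its upper part a symmetric one. *)
Definition code_trig Q : 'M['F_2]_m :=
  \matrix_(i, j) if i == j then 1 else if (i < j)%N then Q j i else 0.

Definition code_sym Q : 'M['F_2]_m :=
  \matrix_(i, j) if (i <= j)%N then Q i j else Q j i.

Lemma code_trig_trig Q : is_trig_mx (code_trig Q)^T.
Proof.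
apply/is_trig_mxP => i j lt_ij; rewrite !mxE; case: eqP => [E|_].
  by rewrite E ltnn in lt_ij.
by rewrite ltnNge ltnW.
Qed.

Lemma code_trig_unit Q : code_trig Q \in unitmx.
Proof.
rewrite -unitmx_tr unitmxE (det_trig (code_trig_trig Q)) big1 ?unitr1 // => i _.
by rewrite !mxE eqxx.
Qed.

Definition borel_code Q : 'M['F_2]_(m + m) :=
  block_mx (code_trig Q) (code_trig Q *m code_sym Q) 0 (invmx (code_trig Q)^T).

Lemma borel_code_inj : injective borel_code.
Proof.
move=> Q Q' /eq_block_mx[EA + _ _]; rewrite EA.
move=> /(can_inj (mulKmx (code_trig_unit Q'))) EC.
apply/matrixP => i j; case: (leqP i j) => ij.
  by have /matrixP/(_ i j) := EC; rewrite !mxE ij.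
have /matrixP/(_ j i) := EA; rewrite !mxE ij.
by have /negPf -> : j != i by rewrite neq_ltn ij.
Qed.

Lemma borel_codeP M : sympl_borel M = (M \in codom borel_code).
Proof.
rewrite -borel_mxE; apply/existsP/codomP => [[A /existsP[C]]|[Q ->]].
  move=> /and4P[uA tA /eqP sC /eqP ->]; rewrite borel_mul.
  (* Over F_2 an invertible triangular matrix has ones on its diagonal, which leaves the diagonal of
     the code free for that of [C]. *)
  have dA i : A i i = 1.
    apply: F2_neq0; move: uA; rewrite -unitmx_tr unitmxE unitfE (det_trig tA).
    by move=> /prodf_neq0/(_ i isT); rewrite mxE.
  exists (\matrix_(i, j) if (i <= j)%N then C i j else A j i).
  suff [EA EC] : code_trig (\matrix_(i, j) if (i <= j)%N then C i j else A j i) = A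
      /\ code_sym (\matrix_(i, j) if (i <= j)%N then C i j else A j i) = C.
    by rewrite /borel_code EA EC.
  split; apply/matrixP => i j; rewrite !mxE.
    case: eqVneq => [->|]; first by rewrite dA.
    rewrite neq_ltn => /orP[lt_ij|lt_ji]; first by rewrite lt_ij leqNgt lt_ij.
    rewrite ltnNge (ltnW lt_ji) /=; move/is_trig_mxP: tA => /(_ _ _ lt_ji).
    by rewrite mxE.
  case: leqP => // lt_ji; rewrite (ltnW lt_ji).
  by have /matrixP/(_ i j) := sC; rewrite [RHS]mxE => ->.
exists (code_trig Q); apply/existsP; exists (code_sym Q).
rewrite borel_mul code_trig_unit code_trig_trig eqxx andbT /=.
apply/eqP/matrixP => i j; rewrite !mxE; case: ltngtP => // /val_inj -> //.
Qed.

Lemma card_sympl_borel : #|[set M : 'M['F_2]_(m + m) | sympl_borel M]%SET| = (2 ^ m ^ 2)%N.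
Proof.
rewrite -mulnn -[2%N in RHS](card_Fp (isT : prime 2)) -card_mx.
rewrite -(card_codom borel_code_inj) cardsE.
by apply: eq_card => M; rewrite -borel_codeP.
Qed.

End BorelCard.

(** * Lower and upper bounds for the order of the symplectic group *)

Lemma leq_card_fibers (T U : finType) (f : T -> U) (A : {set T}) (V : {set U}) (c : nat) :
  (forall x, x \in A -> f x \in V) ->
  (forall u, u \in V -> #|[set x in A | f x == u]%SET| <= c)%N ->
  (#|A| <= #|V| * c)%N.
Proof.
move=> fV fib; rewrite -sum1_card (partition_big f (mem V)) //=.
rewrite -sum_nat_const; apply: leq_sum => u /fib; apply: leq_trans.
by rewrite sum1dep_card cardsE.
Qed.

Section SymplecticCard.
Variable m : nat.
Implicit Types (M S : 'M['F_2]_(m + m)) (x y : 'I_(m + m)).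

(** The Borel group meets its transpose trivially: a matrix that is both upper and lower triangular
    is diagonal, and over F_2 only the identity is diagonal and invertible. *)
Lemma sympl_borel_tr_eq1 M S : sympl_borel M -> sympl_borel S -> M = S^T -> M = 1%:M.
Proof.
move=> /andP[spM /upper_triP tM] /andP[_ /upper_triP tS] MS.
have diagM x y : x != y -> M x y = 0.
  move=> xy; case: (ltngtP (pos x) (pos y)) => [/tS|/tM|/pos_inj/eqP] //.
    by rewrite MS mxE.
  by rewrite (negPf xy).
apply/matrixP => x y; rewrite mxE; case: eqVneq => [<-|/diagM //].
apply: F2_neq0; apply/eqP => Mxx.
have /matrixP/(_ x x) := mulmxV (sympl_unit spM).
rewrite !mxE eqxx big1 => [/eqP|z _]; first by rewrite eq_sym oner_eq0.
by case: (eqVneq x z) => [<-|/diagM ->]; rewrite ?Mxx mul0r.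
Qed.

Lemma card_symplectic_ge : (2 ^ (2 * m ^ 2) <= #|[set M : 'M['F_2]_(m + m) | symplectic M]%SET|)%N.
Proof.
pose B := [set M : 'M['F_2]_(m + m) | sympl_borel M]%SET.
rewrite mulnC expnM -mulnn -(card_sympl_borel m) -/B -cardsX.
pose f (p : 'M['F_2]_(m + m) * 'M['F_2]_(m + m)) := p.1^T *m p.2.
rewrite -(@card_in_imset _ _ f).
  apply/subset_leq_card/fintype.subsetP => _ /imsetP[[M N] + ->].
  rewrite !inE /f /= => /andP[/andP[spM _] /andP[spN _]].
  by rewrite symplM ?sympl_tr.
move=> [M N] [M' N']; rewrite !inE /f /= => /andP[bM bN] /andP[bM' bN'] E.
have spU (K : 'M['F_2]_(m + m)) : sympl_borel K -> K \in unitmx by case/andP => /sympl_unit.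
(* M^T N = M'^T N' is rearranged so that an element of the Borel group equals one of its
   transpose. *)
have {}E : N *m invmx N' = (M' *m invmx M)^T.
  rewrite trmx_mul trmx_inv -[N](mulKmx (_ : M^T \in unitmx)) ?unitmx_tr ?spU //.
  by rewrite E !mulmxA mulmxK ?spU.
have := sympl_borel_tr_eq1 (sympl_borelM bN (sympl_borelV bN'))
  (sympl_borelM bM' (sympl_borelV bM)) E.
move: E => /[swap] NN'; rewrite NN' => /(congr1 trmx); rewrite trmx1 trmxK => MM'.
by rewrite -[N](mulmxKV (spU _ bN')) NN' mul1mx -[M'](mulmxKV (spU _ bM)) -MM' mul1mx.
Qed.

(** Pointwise stabilizer of the first [k] basis vectors, in the index order e_1, ..., e_m, f_1, ...,
    f_m and not in the order [pos]. *)
Definition sympl_stab k : {set 'M['F_2]_(m + m)} :=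
  [set M | symplectic M & [forall x : 'I_(m + m), (x < k)%N ==> (col x M == col x 1%:M)]]%SET.

Lemma sympl_stabP k M : reflect
  (symplectic M /\ forall x : 'I_(m + m), (x < k)%N -> unit_col M x x) (M \in sympl_stab k).
Proof.
rewrite inE; apply: (iffP andP) => -[spM H]; split=> //.
  move=> x ltxk i; move/forallP/(_ x): H => /implyP/(_ ltxk)/eqP/colP/(_ i).
  by rewrite !mxE.
apply/forallP => x; apply/implyP => /H Hx; apply/eqP/colP => i.
by rewrite !mxE Hx.
Qed.

(* Pairing the column [k] with the fixed columns [x < k] prescribes its
   coordinates [conj_ord x], leaving at most [m + m - k] free ones. *)
Lemma card_sympl_stabS k : (k < m + m)%N ->
  (#|sympl_stab k| <= 2 ^ (m + m - k) * #|sympl_stab k.+1|)%N.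
Proof.
move=> lt_k; pose k0 := Ordinal lt_k.
have kj (j : 'I_(m + m - k)) : (k + j < m + m)%N by have := ltn_ord j; lia.
pose f M := [ffun j : 'I_(m + m - k) => M (conj_ord (Ordinal (kj j))) k0].
have -> : (2 ^ (m + m - k) = #|[set: {ffun 'I_(m + m - k) -> 'F_2}]%SET|)%N.
  by rewrite cardsT card_ffun !card_ord.
apply: (leq_card_fibers (f := f)) => [M|u] _; first by rewrite inE.
case: (set_0Vmem [set M in sympl_stab k | f M == u]%SET) => [->|[M0]]; first by rewrite cards0.
rewrite inE => /andP[/sympl_stabP[spM0 fixM0] /eqP fM0].
have uM0 := sympl_unit spM0.
(* Left multiplication by the inverse of one member [M0] embeds the fiber into the next
   stabilizer. *)
rewrite -(card_imset _ (can_inj (mulKVmx uM0))).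
apply/subset_leq_card/fintype.subsetP => _ /imsetP[M + ->].
rewrite inE => /andP[/sympl_stabP[spM fixM] /eqP fM].
have eqcol x i : (x < k.+1)%N -> M i x = M0 i x.
  rewrite ltnS leq_eqVlt => /orP[/eqP xk|xk]; last by rewrite fixM ?fixM0.
  have {xk} -> : x = k0 by apply: val_inj.
  rewrite -[i]conj_ordK; move: (conj_ord i) => {i} i.
  case: (ltnP i k) => ik.
    by rewrite (sympl_col_unit spM (fixM _ ik)) (sympl_col_unit spM0 (fixM0 _ ik)).
  have ij : (i - k < m + m - k)%N by have := ltn_ord i; lia.
  have -> : i = Ordinal (kj (Ordinal ij)) by apply: val_inj => /=; lia.
  by move/ffunP/(_ (Ordinal ij)): fM; rewrite -fM0 !ffunE.
apply/sympl_stabP; split; first by rewrite symplM ?symplV.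
move=> x xk i; have := mulVmx uM0 => /matrixP/(_ i x); rewrite !mxE => <-.
by apply: eq_bigr => j _; rewrite eqcol.
Qed.

Lemma card_symplectic_le : (#|[set M : 'M['F_2]_(m + m) | symplectic M]%SET| <= 2 ^ (2 * m ^ 2 + m))%N.
Proof.
(* The exponents 1 + ... + d add up to this binomial coefficient; d = 2m gives 2m^2 + m. *)
have H d : (d <= m + m)%N -> (#|sympl_stab (m + m - d)| <= 2 ^ 'C(d.+1, 2))%N.
  elim: d => [_|d IHd lt_d].
    rewrite subn0; apply: (@leq_trans #|[set (1%:M : 'M['F_2]_(m + m))]%SET|);
      last by rewrite cards1.
    apply/subset_leq_card/fintype.subsetP => M /sympl_stabP[_ fixM].
    by rewrite inE; apply/eqP/matrixP => i j; rewrite fixM // mxE.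
  have lt_k : (m + m - d.+1 < m + m)%N by lia.
  apply: leq_trans (card_sympl_stabS lt_k) _.
  have -> : (m + m - (m + m - d.+1) = d.+1)%N by lia.
  have -> : ((m + m - d.+1).+1 = m + m - d)%N by lia.
  rewrite [in leqRHS]binS bin1 addnC expnD leq_mul2l IHd ?orbT //; lia.
have := H _ (leqnn (m + m)); rewrite subnn.
have -> : 'C((m + m).+1, 2) = (2 * m ^ 2 + m)%N by rewrite bin2 /= -mulnn; nia.
apply: leq_trans; apply/subset_leq_card/fintype.subsetP => M.
by rewrite inE => spM; apply/sympl_stabP.
Qed.

End SymplecticCard.

(** * The subgroups of GL: identification of W_n, surjectivity and cardinalities *)

Section BruhatGroups.
Variable n : nat.
Local Notation m := n.-1.+1.
Implicit Types (g h : qGL n) (M : 'M['F_2]_(m + m)).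

Lemma GLmx_inj : injective (@GLmx n).
Proof. exact: val_inj. Qed.

Lemma GLmxM g h : GLmx (g * h)%g = GLmx g *m GLmx h.
Proof. by []. Qed.

Lemma GLmxV g : GLmx g^-1%g = invmx (GLmx g).
Proof. by []. Qed.

Lemma GLmx_lift M : M \in unitmx -> exists g : qGL n, GLmx g = M.
Proof. by move=> uM; exists (FinRing.unit _ uM). Qed.

Lemma in_Sp g : (g \in Sp n) = symplectic (GLmx g).
Proof. by rewrite inE. Qed.

Lemma in_Borel g : (g \in Borel n) = sympl_borel (GLmx g).
Proof. by rewrite inE borel_mxE. Qed.

Lemma sympl_lift M : symplectic M -> exists g, GLmx g = M.
Proof. by move=> /sympl_unit; apply: GLmx_lift. Qed.

Lemma card_GLmx (P : pred 'M['F_2]_(m + m)) : (forall M, P M -> symplectic M) ->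
  #|[set g : qGL n | P (GLmx g)]%SET| = #|[set M | P M]%SET|.
Proof.
move=> spP; rewrite -(card_imset _ GLmx_inj); apply: eq_card => M; rewrite inE.
apply/imsetP/idP => [[g + ->]|PM]; first by rewrite inE.
by have [g gM] := sympl_lift (spP _ PM); exists g; rewrite ?inE gM.
Qed.

Definition conj_perm_set : {set qGL n} :=
  [set g | [exists s, conj_perm s && (GLmx g == perm_mx s)]]%SET.

Lemma conj_perm_setP g : reflect (exists2 s, conj_perm s & GLmx g = perm_mx s)
  (g \in conj_perm_set).
Proof.
rewrite inE; apply: (iffP existsP) => [[s /andP[cs /eqP]]|[s cs gs]]; exists s => //.
by rewrite cs gs eqxx.
Qed.

Lemma conj_perm_group_set : group_set conj_perm_set.
Proof.
apply/group_setP; split=> [|g h].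
  by apply/conj_perm_setP; exists 1%g; rewrite ?conj_perm1 // perm_mx1.
move=> /conj_perm_setP[s cs gs] /conj_perm_setP[t ct ht].
by apply/conj_perm_setP; exists (s * t)%g; rewrite ?conj_permM // GLmxM gs ht perm_mxM.
Qed.

Canonical conj_perm_group := Group conj_perm_group_set.

(** The right side is a group containing the generators; conversely [conj_perm_ind] reaches each of
    its elements from them. *)
Lemma WeylE : Weyl n = conj_perm_set.
Proof.
apply/eqP; rewrite finset.eqEsubset; apply/andP; split.
  rewrite gen_subG; apply/fintype.subsetP => g /setUP[]; rewrite inE.
    move=> /existsP[k /eqP gk]; apply/conj_perm_setP; exists (hadamard_perm k) => //.
    exact: conj_hadamard_perm.
  move=> /existsP[t /eqP gt]; apply/conj_perm_setP; exists (qubit_perm t).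
    exact: conj_qubit_perm.
  by rewrite gt qubit_perm_mxE.
apply/fintype.subsetP => g /conj_perm_setP[s cs].
elim/conj_perm_ind: s / cs g => [|s t Hs Ht|s Hs|k|t] g gE.
- suff -> : g = 1%g by exact: group1.
  by apply: GLmx_inj; rewrite gE perm_mx1.
(* For a product, [g] is factored through a lift [h] of the first permutation. *)
- have [h hs] : exists h, GLmx h = perm_mx s by apply/GLmx_lift/unitmx_perm.
  have -> : g = (h * (h^-1 * g))%g by rewrite mulKVg.
  apply: groupM; first exact: Hs.
  apply: Ht; by rewrite GLmxM GLmxV hs gE perm_mxM mulKmx ?unitmx_perm.
- rewrite -groupV; apply: Hs; rewrite GLmxV gE -[in RHS](invgK s).
  apply: (can_inj (mulKmx (unitmx_perm _ s^-1%g))).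
  by rewrite mulmxV ?unitmx_perm // -perm_mxM mulgV perm_mx1.
- by apply/mem_gen/setUP; left; rewrite inE; apply/existsP; exists k; rewrite gE.
- by apply/mem_gen/setUP; right; rewrite inE; apply/existsP; exists t; rewrite gE qubit_perm_mxE.
Qed.

Lemma card_Weyl_le : (#|Weyl n| <= (m + m)`!)%N.
Proof.
rewrite WeylE -(card_imset _ GLmx_inj) -card_Sn.
apply: leq_trans (leq_imset_card (@perm_mx 'F_2 (m + m)) _).
apply/subset_leq_card/fintype.subsetP => _ /imsetP[g /conj_perm_setP[s _ gs] ->].
by rewrite gs imset_f.
Qed.

Lemma bruhat_surj : [set bruhat_map p | p in bruhat_dom n]%SET = Sp n.
Proof.
apply/setP => g; rewrite in_Sp; apply/imsetP/idP => [[[[b1 w] b2] + ->]|spg].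
  rewrite !finset.in_setX /= !in_Borel WeylE.
  move=> /andP[/andP[/andP[sp1 _] /conj_perm_setP[s cs ws]] /andP[sp2 _]].
  suff: symplectic (GLmx b1 *m GLmx w *m GLmx b2) by [].
  by rewrite ws !symplM // sympl_perm_mx.
have [c1 [c2 [bc1 bc2 unitg]]] := elimination spg.
have [sp1 sp2] : symplectic c1 /\ symplectic c2 by case/andP: bc1; case/andP: bc2.
have [s cs cE] := unit_cols_perm_mx (symplM (symplM sp1 spg) sp2) unitg.
have [b1 b1E] := sympl_lift sp1; have [b2 b2E] := sympl_lift sp2.
exists (b1^-1, b1 * g * b2, b2^-1)%g; last by rewrite /bruhat_map /= !mulgA mulVg mul1g mulgK.
rewrite !finset.in_setX /= !in_Borel !GLmxV b1E b2E !sympl_borelV //= andbT WeylE.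
by apply/conj_perm_setP; exists s => //; rewrite !GLmxM b1E b2E.
Qed.

Lemma card_Borel : #|Borel n| = (2 ^ m ^ 2)%N.
Proof.
rewrite -card_sympl_borel -card_GLmx; last by move=> M /andP[].
by apply: eq_card => g; rewrite in_Borel inE.
Qed.

Lemma card_bruhat_dom : #|bruhat_dom n| = (2 ^ (2 * m ^ 2) * #|Weyl n|)%N.
Proof. by rewrite !cardsX card_Borel mulnAC -expnD addnn mul2n. Qed.

Lemma card_Sp : #|Sp n| = #|[set M : 'M['F_2]_(m + m) | symplectic M]%SET|.
Proof. by rewrite -card_GLmx. Qed.

End BruhatGroups.

(** * Logarithms of the cardinalities and their asymptotics *)

Lemma fact_le_expn n : (n`! <= n ^ n)%N.
Proof.
elim: n => // n IHn; rewrite factS expnS leq_mul2l /=.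
by apply: leq_trans IHn _; case: (posnP n) => [->|n0] //; rewrite leq_exp2r.
Qed.

Section Asymptotics.
Variable R : realType.

Lemma ln2_gt0 : 0 < ln 2 :> R.
Proof. by apply: ln_gt0; rewrite ltr1n. Qed.

Lemma boolean_dof_ge (T : finType) (A : {set T}) k :
  (2 ^ k <= #|A|)%N -> k%:R <= boolean_dof R A.
Proof.
move=> le_kA; rewrite /boolean_dof ler_pdivlMr ?ln2_gt0 // mulr_natl -lnXn //.
rewrite ler_ln ?posrE ?exprn_gt0 // -?natrX ?ler_nat //.
by rewrite ltr0n (leq_trans _ le_kA) ?expn_gt0.
Qed.

Lemma boolean_dof_le (T : finType) (A : {set T}) k :
  (0 < #|A|)%N -> (#|A| <= 2 ^ k)%N -> boolean_dof R A <= k%:R.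
Proof.
move=> A0 le_Ak; rewrite /boolean_dof ler_pdivrMr ?ln2_gt0 // mulr_natl -lnXn //.
by rewrite ler_ln ?posrE ?exprn_gt0 ?ltr0n // -natrX ler_nat.
Qed.

(** With x = 2n, ln x = 2 ln(sqrt x) <= 2 sqrt x, and 2 sqrt(2n) <= e n as soon as 8 / e^2 <= n. *)
Lemma ln_le_linear (e : R) : 0 < e -> \forall n \near \oo, ln (n + n)%N%:R <= e * n%:R.
Proof.
move=> e0; near=> n.
have n0 : 0 < n%:R :> R by rewrite ltr0n; near: n; exact: nbhs_infty_gt.
have nn0 : 0 < (n + n)%N%:R :> R by rewrite natrD addr_gt0.
have s0 : 0 < Num.sqrt (n + n)%N%:R :> R by rewrite sqrtr_gt0.
rewrite -[X in ln X]sqr_sqrtr ?(ltW nn0) // lnXn // mulr2n.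
apply: le_trans (lerD (ltW (ln_sublinear s0)) (ltW (ln_sublinear s0))) _.
rewrite -(ler_pXn2r (n := 2)) ?nnegrE ?addr_ge0 ?mulr_ge0 ?(ltW s0) ?(ltW n0) ?(ltW e0) //.
rewrite -mulr2n exprMn_n sqr_sqrtr ?(ltW nn0) // exprMn.
have : 8 / e ^+ 2 <= n%:R by near: n; exact: nbhs_infty_ger.
rewrite ler_pdivrMr ?exprn_gt0 // natrD => H.
have := ler_wpM2r (ltW n0) H.
by rewrite [_ ^+ 2 * _]mulrC expr2; lra.
Unshelve. all: by end_near.
Qed.

Lemma dof_Sp_bounds n : (0 < n)%N ->
  2 * n%:R ^+ 2 <= boolean_dof R (Sp n) <= 2 * n%:R ^+ 2 + n%:R.
Proof.
move=> n0; have nE : n.-1.+1 = n by rewrite prednK.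
have geSp : (2 ^ (2 * n ^ 2) <= #|Sp n|)%N.
  by rewrite card_Sp; apply: leq_trans (card_symplectic_ge _); rewrite nE.
rewrite -natrX -natrM -natrD boolean_dof_ge //=; apply: boolean_dof_le.
  by rewrite (leq_trans _ geSp) ?expn_gt0.
by rewrite card_Sp; apply: leq_trans (card_symplectic_le _) _; rewrite nE.
Qed.

Lemma dof_bruhat_bounds n : (0 < n)%N -> 2 * n%:R ^+ 2 <= boolean_dof R (bruhat_dom n)
  <= 2 * n%:R ^+ 2 + (n + n)%N%:R * ln (n + n)%N%:R / ln 2.
Proof.
move=> n0; have nE : n.-1.+1 = n by rewrite prednK.
have W0 : (0 < #|Weyl n|)%N by rewrite cardG_gt0.
(* This crude bound suffices: W_n contributes only O(n log n) bits. *)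
have le_W : (#|Weyl n| <= (n + n) ^ (n + n))%N.
  by apply: leq_trans (card_Weyl_le n) _; rewrite nE fact_le_expn.
have cB : #|bruhat_dom n| = (2 ^ (2 * n ^ 2) * #|Weyl n|)%N.
  by rewrite card_bruhat_dom; congr (_ * _)%N; rewrite nE.
rewrite -natrX -natrM boolean_dof_ge ?cB ?leq_pmulr //=.
rewrite /boolean_dof cB ler_pdivrMr ?ln2_gt0 // mulrDl divfK ?gt_eqF ?ln2_gt0 //.
have nn0 : (0 < n + n)%N by rewrite addn_gt0 n0.
rewrite natrM lnM ?posrE ?ltr0n ?expn_gt0 // natrX lnXn // !mulr_natl lerD2l.
rewrite -lnXn ?ltr0n // -natrX ler_ln ?posrE ?ltr0n ?ler_nat //.
by rewrite expn_gt0 nn0.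
Qed.

Lemma dof_bruhat_littleo (e : R) : 0 < e -> \forall n \near \oo,
  `|boolean_dof R (bruhat_dom n) - 2 * n%:R ^+ 2| <= e * n%:R ^+ 2.
Proof.
(* The constant is such that 2n ln(2n) / ln 2 <= e n^2 follows from ln(2n) <= (e ln 2 / 2) n. *)
move=> e0; have eL : 0 < e * ln 2 / 2 by rewrite divr_gt0 ?mulr_gt0 ?ln2_gt0.
near=> n; have n0 : (0 < n)%N by near: n; exact: nbhs_infty_gt.
have /andP[lo hi] := dof_bruhat_bounds n0.
rewrite ger0_norm ?subr_ge0 // lerBlDl (le_trans hi) // lerD2l.
have H : ln (n + n)%N%:R <= e * ln 2 / 2 * n%:R.
  by near: n; exact: ln_le_linear.
rewrite ler_pdivrMr ?ln2_gt0 //.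
have := ler_wpM2l (ler0n R (n + n)) H; rewrite natrD.
by move=> H'; apply: le_trans H' _; rewrite le_eqVlt; apply/orP; left; apply/eqP; field.
Unshelve. all: by end_near.
Qed.

End Asymptotics.

Theorem corollary16 (R : realType) :
  (forall n : nat, (0 < n)%N ->
     [set bruhat_map p | p in bruhat_dom n]%SET = Sp n) /\
  (fun n : nat => boolean_dof R (bruhat_dom n)) =
    (fun n : nat => 2 * n%:R ^+ 2) +o_\oo (fun n : nat => n%:R ^+ 2 : R) /\
  (fun n : nat => boolean_dof R (Sp n)) =
    (fun n : nat => 2 * n%:R ^+ 2) +O_\oo (fun n : nat => n%:R : R) /\
  (fun n : nat => boolean_dof R (bruhat_dom n)) ~_\oo
    (fun n : nat => boolean_dof R (Sp n)).
Proof.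
split; first by move=> n _; exact: bruhat_surj.
split.
  apply/eqaddoP => e e0; near=> n.
  rewrite [`|n%:R ^+ 2|]ger0_norm ?exprn_ge0 //.
  by near: n; exact: dof_bruhat_littleo.
split.
  (* The error lies between 0 and n, so any constant [k] of at least 1 works. *)
  apply/eqaddOP; near=> k => /=; near=> n.
  have n0 : (0 < n)%N by near: n; exact: nbhs_infty_gt.
  have /andP[lo hi] := dof_Sp_bounds R n0.
  rewrite [X in `|X| <= _]/(_ - _) /= ger0_norm ?subr_ge0 // normr_nat.
  apply: le_trans (_ : n%:R <= _); first by rewrite lerBlDl.
  by rewrite ler_peMl //; near: k; exact: nbhs_pinfty_ge.
(* Both quantities are within e n^2 of 2n^2, the second once n >= 1/e; and e (2n^2) is at most e
   times the lower bound for Sp. *)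
apply/eqaddoP => e e0; near=> n.
have n0 : (0 < n)%N by near: n; exact: nbhs_infty_gt.
have /andP[lo hi] := dof_Sp_bounds R n0.
have H : `|boolean_dof R (bruhat_dom n) - 2 * n%:R ^+ 2| <= e * n%:R ^+ 2.
  by near: n; exact: dof_bruhat_littleo.
have He : e^-1 <= n%:R by near: n; exact: nbhs_infty_ger.
have n0' : 0 < n%:R :> R by rewrite ltr0n.
have Hn : n%:R <= e * n%:R ^+ 2.
  by rewrite expr2 mulrA ler_peMl ?(ltW n0') // mulrC -ler_pdivrMr // mul1r.
apply: le_trans (_ : e * (2 * n%:R ^+ 2) <= _).
  rewrite -[X in `|X| <= _]/(boolean_dof R (bruhat_dom n) - boolean_dof R (Sp n)).
  rewrite -[boolean_dof R (bruhat_dom n)](subrK (2 * n%:R ^+ 2)) -addrA.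
  apply: le_trans (ler_normD _ _) _.
  have : `|2 * n%:R ^+ 2 - boolean_dof R (Sp n)| <= n%:R.
    by rewrite distrC ger0_norm ?subr_ge0 // lerBlDl.
  lra.
by rewrite ler_pM2l // ger0_norm // (le_trans _ lo) // mulr_ge0 ?exprn_ge0.
Unshelve. all: by end_near.
Qed.
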